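(* For every graph $G$ of order $n$, one has $\chi_{\ell}(G) \le 6\vec{\chi}(G)\left(1+\lfloor \log_2 n\rfloor\right)$.
   Context: $\chi_\ell(G)$ is the list-chromatic number (choosability) of $G$: the minimum $k$ such that for every assignment $L$ of a set $L(v)$ of $k$ colours to each vertex $v$, there is a proper colouring $c$ with $c(v)\in L(v)$ for all $v$. For a digraph $D$, a $k$-dicolouring is a map $\phi: V(D)\to\{1,\dots,k\}$ such that each colour class induces an acyclic subdigraph; the dichromatic number $\vec\chi(D)$ is the least such $k$. For an undirected graph $G$, $\vec{\chi}(G)$ denotes the maximum of $\vec\chi(\vec G)$ over all orientations $\vec G$ of $G$. *)

(* Defs.v *)
From HB Require Import structures.
From mathcomp Require Import all_boot finmap boolp.

Set Implicit Arguments.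
Unset Strict Implicit.
Unset Printing Implicit Defensive.

Local Open Scope fset_scope.

Record sgraph (T : finType) := SGraph {
  edge :> rel T;
  edge_sym : symmetric edge;
  edge_irr : irreflexive edge }.

(* Digraphs are loopless (a loop admits no dicolouring) and given by their arc
   sets, so that the digraphs on [T] form a finite type; digons are allowed. *)
Definition loopless (T : finType) (A : {set T * T}) : bool :=
  [forall x, (x, x) \notin A].

Definition digraph (T : finType) := {A : {set T * T} | loopless A}.

Definition arc (T : finType) (D : digraph T) : rel T :=
  [rel x y | (x, y) \in val D].

Definition orientation (T : finType) (G : sgraph T) (D : digraph T) : bool :=
  [forall x, forall y, (G x y == (arc D x y || arc D y x))
                       && ~~ (arc D x y && arc D y x)].

Definition acyclic (T : finType) (r : rel T) : Prop :=
  forall c : seq T, ucycle r c -> c = [::].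

Definition induced (T : finType) (D : digraph T) (A : {set T}) : rel T :=
  [rel x y | [&& x \in A, y \in A & arc D x y]].

Definition dicolouring (T : finType) (D : digraph T) (k : nat)
    (phi : T -> 'I_k) : Prop :=
  forall i : 'I_k, acyclic (induced D [set x | phi x == i]).

Definition dicolourable (T : finType) (D : digraph T) (k : nat) : Prop :=
  exists phi : T -> 'I_k, dicolouring D phi.

Lemma dicolourable_ex (T : finType) (D : digraph T) :
  exists k, `[< dicolourable D k >].
Proof.
exists #|T|; apply/asboolP; exists enum_rank => i [//|x [|y c]].
  move=> /andP[/= /andP[/and3P[_ _ Dxx] _] _].
  by move/forallP: (valP D) => /(_ x)/negP/(_ Dxx).
move=> /andP[/= /andP[/and3P[]]]; rewrite !inE => /eqP<- /eqP/enum_rank_inj-> _.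
by rewrite eqxx.
Qed.

Definition dichromatic (T : finType) (D : digraph T) : nat :=
  ex_minn (dicolourable_ex D).

Lemma orientation_ex (T : finType) (G : sgraph T) :
  exists D : digraph T, orientation G D.
Proof.
pose A := [set p : T * T | G p.1 p.2 && (enum_rank p.1 < enum_rank p.2)].
have lA : loopless A by apply/forallP=> x; rewrite inE /= edge_irr.
exists (exist _ A lA); apply/forallP=> x; apply/forallP=> y.
rewrite /arc /= !inE /= (edge_sym G y x).
case Gxy: (G x y) => //=; case: ltngtP => //= /val_inj/enum_rank_inj xy.
by rewrite xy edge_irr in Gxy.
Qed.

(* By [orientation_ex], this maximum is over a nonempty set. *)
Definition graph_dichromatic (T : finType) (G : sgraph T) : nat :=
  \max_(D : digraph T | orientation G D) dichromatic D.

Definition proper_colouring (T : finType) (G : sgraph T) (C : Type)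
    (c : T -> C) : Prop :=
  forall x y, G x y -> c x <> c y.

Definition choosable (T : finType) (G : sgraph T) (k : nat) : Prop :=
  forall (C : choiceType) (L : T -> {fset C}),
    (forall v, #|` L v| = k) ->
    exists c : T -> C, proper_colouring G c /\ forall v, c v \in L v.

Lemma choosable_ex (T : finType) (G : sgraph T) :
  exists k, `[< choosable G k >].
Proof.
exists #|T|; apply/asboolP => C L sL.
have ex0 v : exists a, a \in L v.
  by apply/fset0Pn; rewrite -cardfs_gt0 sL; apply/card_gt0P; exists v.
suff [c [cL cI]] : exists c : T -> C, (forall v, c v \in L v) /\
    {in enum T &, injective c}.
  exists c; split=> // x y Gxy cxy.
  by move: Gxy; rewrite (cI x y) ?mem_enum// edge_irr.
have: size (enum T) <= #|T| by rewrite cardE.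
elim: (enum T) => [|v s IH] /= ss.
  by exists (fun v => xchoose (ex0 v)); split=> // v; apply: xchooseP.
have [c [cL cI]] := IH (ltnW ss).
have [vs|vs] := boolP (v \in s).
  exists c; split=> // x y.
  by rewrite !inE => /predU1P[->|xs] /predU1P[->|ys] //; apply: cI.
have /fset0Pn[a] : L v `\` [fset x in map c s] != fset0.
  rewrite fsetD_eq0; apply/negP => /fsubset_leq_card; rewrite sL leqNgt.
  have le : #|` [fset x in map c s]| <= size s.
    by rewrite card_fseq (leq_trans (size_undup _)) // size_map.
  by rewrite (leq_ltn_trans le ss).
rewrite !inE => /andP[aN aL].
exists (fun x => if x == v then a else c x); split=> [x|x y].
  by case: eqP => [->|_].
rewrite !inE; case: (eqVneq x v) => [->|xv] /=;
  case: (eqVneq y v) => [->|yv] //= xs ys; last exact: cI.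
- by move=> ac; rewrite ac map_f in aN.
- by move=> ac; rewrite -ac map_f in aN.
Qed.

Definition list_chromatic (T : finType) (G : sgraph T) : nat :=
  ex_minn (choosable_ex G).

(* Main.v *)
(** Let [t = 1 + trunc_log 2 n], so [n < 2 ^ t]. In a uniformly random
    orientation, a fixed ordering of a set [A] spanning at least [|A| (t + 1)]
    edges is topological with probability at most [2 ^ - |A| (t + 1)]; a union
    bound over the orderings yields an orientation in which every acyclic set is
    [(2t + 1)]-degenerate in [G]. Dicolour it with [k] classes, and give each
    colour of the lists to a random class: of the [6 k t] colours of a vertex, more
    than [2t + 1] fall in its own class with probability above [1 - 1/n]. A greedy
    colouring inside each class then finishes. *)
From mathcomp Require Import all_boot finmap boolp zify.
Require Import Defs.

Set Implicit Arguments.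
Unset Strict Implicit.
Unset Printing Implicit Defensive.

(** * Counting tools *)

Lemma union_bound (U I : finType) (B : I -> {set U}) :
  (forall x, exists i, x \in B i) -> #|U| <= \sum_i #|B i|.
Proof.
move=> cov; under eq_bigr do rewrite -sum1_card.
rewrite (exchange_big_dep predT)//= -sum1_card leq_sum// => x _.
by have [i xi] := cov x; rewrite (bigD1 i).
Qed.

(** As [B a <= M / 2 ^ a], the sum is at most [M (1 - 2 ^ -n)]; the induction runs on this bound
    multiplied by [2 ^ n]. *)
Lemma geometric_sum_lt (B : nat -> nat) (M n : nat) :
  0 < M -> (forall a, 0 < a -> B a * 2 ^ a <= M) ->
  \sum_(1 <= a < n.+1) B a < M.
Proof.
move=> M0 BM; suff: (\sum_(1 <= a < n.+1) B a) * 2 ^ n + M <= M * 2 ^ n.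
  by have := expn_gt0 2 n; nia.
elim: n => [|n IH]; first by rewrite big_geq// expn0; lia.
rewrite big_nat_recr//= mulnDl.
have := BM n.+1 isT; move: IH; rewrite expnS; nia.
Qed.

(** Such an [F] is determined by [F :\: P], a subset of the complement of [P]. *)
Lemma card_setI_fiber (U : finType) (P Q : {set U}) :
  #|[set F : {set U} | F :&: P == Q]| <= 2 ^ (#|U| - #|P|).
Proof.
have -> : #|U| - #|P| = #|~: P| by have := cardsC P; lia.
rewrite -card_powerset.
rewrite -(card_in_imset (f := fun F => F :\: P)).
  by apply/subset_leq_card/subsetP=> _ /imsetP[F _ ->]; rewrite inE subDset setUCr subsetT.
move=> F F'; rewrite !inE => /eqP FQ /eqP F'Q FF'.
by rewrite -(setID F P) FQ FF' -F'Q setID.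
Qed.

Lemma handshake (T : finType) (G : sgraph T) (A : {set T}) :
  \sum_(x in A) #|[set y in A | G x y]| =
  2 * #|[set p | [&& p.1 \in A, p.2 \in A, G p.1 p.2
                   & enum_rank p.1 < enum_rank p.2]]|.
Proof.
pose lt x y := (x \in A) && (y \in A) && G x y && (enum_rank x < enum_rank y).
have -> : #|[set p | [&& p.1 \in A, p.2 \in A, G p.1 p.2
                   & enum_rank p.1 < enum_rank p.2]]| = \sum_x \sum_y lt x y.
  rewrite pair_big/=; apply: etrans (esym (sum1_card _)) _.
  rewrite big_mkcond/=; apply: eq_bigr => -[x y] _.
  by rewrite inE/= /lt -!andbA; case: ifP.
have -> : \sum_(x in A) #|[set y in A | G x y]| = \sum_x \sum_y (lt x y + lt y x).
  rewrite big_mkcond/=; apply: eq_bigr => x _.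
  rewrite -sum1_card big_mkcond/=; case: ifP => xA.
    apply: eq_bigr => y _; rewrite inE /lt xA (edge_sym G y x) andbT.
    case: (y \in A) => //=; case Gxy: (G x y) => //=.
    by case: ltngtP => // /val_inj/enum_rank_inj xy; rewrite xy edge_irr in Gxy.
  by rewrite big1// => y _; rewrite /lt xA !andbF.
under eq_bigr do rewrite big_split/=.
by rewrite big_split/= [X in _ + X]exchange_big/= addnn mul2n.
Qed.

(** * Topological orders of acyclic sets *)

(** If every vertex of [A] had an out-neighbour in [A], following a chosen one would run into a
    directed cycle. *)
Lemma acyclic_sink (T : finType) (D : digraph T) (A : {set T}) :
  acyclic (induced D A) -> A != set0 ->
  exists2 x, x \in A & forall y, y \in A -> ~~ arc D x y.
Proof.
move=> acA /set0Pn[x0 x0A]; apply: contrapT => nosink.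
have ex x : x \in A -> exists y, (y \in A) && arc D x y.
  move=> xA; apply: contrapT => ny; apply: nosink; exists x => // y yA.
  by apply/negP => xy; apply: ny; exists y; rewrite yA.
pose f x := odflt x [pick y | (y \in A) && arc D x y].
have fP x : x \in A -> f x \in A /\ arc D x (f x).
  move=> xA; rewrite /f; case: pickP => [y /andP[]//|no].
  by have [y] := ex _ xA; rewrite no.
(* As the orbit of [f x] lies in that of [x], minimality makes them equally large, so [x] lies on a
   cycle of [f]. *)
case: (arg_minnP (fun x => order f x) x0A) => x xA xmin.
have cyc : fcycle f (orbit f x).
  apply/(orbitPcycle 0 1); apply/eqP; rewrite eqn_leq.
  apply/andP; split; last by apply: xmin; have [] := fP _ xA.
  apply/subset_leq_card/subsetP => y; rewrite !inE.
  exact/connect_trans/fconnect1.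
have itA m : iter m f x \in A by elim: m => //= m /fP[].
have orbA : all (mem A) (orbit f x).
  by apply/allP => y /trajectP[m _ ->]; apply: itA.
suff /acA/(congr1 size) : ucycle (induced D A) (orbit f x).
  by rewrite size_orbit /= => o0; have := order_gt0 f x; rewrite o0.
apply/andP; split; last exact: orbit_uniq.
apply: (sub_in_cycle _ orbA cyc) => y z yA zA /eqP <-.
by have [fA fD] := fP _ yA; apply/and3P; split.
Qed.

(** A sink goes last; the rest is ordered by induction. *)
Lemma acyclic_order (T : finType) (D : digraph T) (A : {set T}) :
  acyclic (induced D A) ->
  exists s : seq T, [/\ uniq s, s =i A &
    forall x y, x \in A -> y \in A -> arc D x y -> index x s < index y s].
Proof.
elim: {A}#|A| {-2}A (erefl #|A|) => [|a IH] A cA acA.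
  exists [::]; split=> // x; first by rewrite (cards0_eq cA) !inE.
  by rewrite (cards0_eq cA) inE.
have [|v vA vsink] := acyclic_sink acA; first by rewrite -card_gt0 cA.
case: (IH (A :\ v)) => [||s [us sA sD]].
- by move: cA; rewrite (cardsD1 v) vA add1n => -[].
- move=> c /andP[cyc uc]; apply: acA; apply/andP; split=> //.
  apply: sub_cycle cyc => x y /and3P[].
  by rewrite !inE => /andP[_ xA] /andP[_ yA] xy; apply/and3P; split.
have vs : v \notin s by rewrite sA !inE eqxx.
exists (rcons s v); split; first by rewrite rcons_uniq vs.
  by move=> x; rewrite mem_rcons inE sA !inE; case: eqVneq => // ->.
move=> x y xA yA xy.
have xv : x != v by apply/eqP => xv; move: xy; rewrite xv (negPf (vsink _ yA)).
have xs : x \in s by rewrite sA !inE xv.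
rewrite -cats1 !index_cat xs; case: ifP => ys.
  by apply: sD => //; rewrite -sA.
by apply: ltn_addr; rewrite index_mem.
Qed.

(** * Random orientations *)

(* A set [F] of ordered pairs encodes an orientation: only its pairs increasing
   in [enum_rank] are read, so every orientation has the same number of codes. *)
Definition orient (T : finType) (G : sgraph T) (F : {set T * T}) : {set T * T} :=
  [set p | G p.1 p.2 && (if enum_rank p.1 < enum_rank p.2 then p \in F
                         else (p.2, p.1) \notin F)].

Lemma orient_loopless (T : finType) (G : sgraph T) F : loopless (orient G F).
Proof. by apply/forallP => x; rewrite inE /= edge_irr. Qed.

Definition orient_digraph (T : finType) (G : sgraph T) F : digraph T :=
  exist _ (orient G F) (orient_loopless G F).

Lemma orient_orientation (T : finType) (G : sgraph T) F :
  orientation G (orient_digraph G F).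
Proof.
apply/forallP=> x; apply/forallP=> y.
rewrite /arc /= !inE /= (edge_sym G y x).
case Gxy: (G x y) => //=.
case: ltngtP => //= [||/val_inj/enum_rank_inj xy]; try by case: (_ \in F).
by rewrite xy edge_irr in Gxy.
Qed.

Lemma sparse_acyclic_orientation (T : finType) (G : sgraph T) (t : nat) :
  #|T| < 2 ^ t ->
  exists2 D : digraph T, orientation G D &
    forall A : {set T}, A != set0 -> acyclic (induced D A) ->
    exists2 v, v \in A & #|[set y in A | G v y]| <= (2 * t).+1.
Proof.
move=> nt; apply: contrapT => noD.
pose E (A : {set T}) := [set p | [&& p.1 \in A, p.2 \in A, G p.1 p.2
                   & enum_rank p.1 < enum_rank p.2]].
pose dense (s : seq T) :=
  uniq s && [forall v in [set x in s], (2 * t).+1 < #|[set y in [set x in s] | G v y]|].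
(* For a dense [s], these are the codes whose arcs inside [s] all go forward along [s]. *)
pose bad (s : seq T) := if dense s then
  [set F : {set T * T} | F :&: E [set x in s] ==
     [set p in E [set x in s] | index p.1 s < index p.2 s]] else set0.
pose B a := \sum_(s : a.-tuple T) #|bad s|.
(* Lengths start at [1]: the empty sequence is vacuously dense, and every code is bad for it. *)
have cov (F : {set T * T}) :
    exists a : 'I_(#|T|.+1), F \in \bigcup_(s : a.+1.-tuple T) bad s.
  apply: contrapT => nbad; apply: noD.
  exists (orient_digraph G F); first exact: orient_orientation.
  move=> A A0 /acyclic_order[s [us sA sD]].
  apply: contrapT => nv; apply: nbad.
  have sA' : [set x in s] = A by apply/setP => x; rewrite inE sA.
  have sz : size s = #|A| by rewrite -sA' cardsE (card_uniqP us).
  have [a ha] : {a : 'I_(#|T|.+1) | size s = a.+1}.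
    have : #|A|.-1 < #|T|.+1 by rewrite ltnS (leq_trans (leq_pred _)) ?max_card.
    by move=> h; exists (Ordinal h); rewrite /= prednK ?card_gt0.
  exists a; apply/bigcupP; exists (tcast ha (in_tuple s)) => //.
  rewrite val_tcast /bad ifT.
    rewrite !inE sA'; apply/eqP/setP => -[x y]; rewrite !inE/=.
    case: (boolP [&& x \in A, y \in A, G x y & _]) => [/and4P[xA yA Gxy xy]|]; last by rewrite andbF.
    rewrite andbT /=; apply/idP/idP => [xyF|].
      by apply: sD => //; rewrite /arc/= inE/= Gxy xy.
    apply: contraTT => xyF; rewrite -leqNgt; apply: ltnW; apply: sD => //.
    by rewrite /arc/= inE/= edge_sym Gxy ltnNge (ltnW xy).
  rewrite /dense us sA'; apply/forall_inP => v vA; rewrite ltnNge.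
  by apply/negP => h; apply: nv; exists v.
(* There are at most [2 ^ (a t)] tuples, each bad for a fraction at most [2 ^ -(a (t + 1))] of the
   codes; a factor [2 ^ -a] is left for the sum over [a]. *)
have Bgeo a : 0 < a -> B a * 2 ^ a <= 2 ^ #|{: T * T}|.
  move=> a0; have bads (s : a.-tuple T) :
      #|bad s| * 2 ^ (a * t.+1) <= 2 ^ #|{: T * T}|.
    rewrite /bad; case: ifP => [/andP[us /forall_inP hs]|]; last by rewrite cards0.
    have cE : a * t.+1 <= #|E [set x in s]|.
      (* All degrees inside [s] are at least [2t + 2], so half their sum is at least [a (t + 1)]. *)
      rewrite -(leq_pmul2l (isT : 0 < 2)) -handshake mulnCA.
      have {1}<- : #|[set x in s]| = a.
        by rewrite cardsE (card_uniqP us) size_tuple.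
      rewrite -sum_nat_const leq_sum// => x xs.
      by apply: leq_trans (hs x xs); lia.
    apply: leq_trans (_ : 2 ^ (#|{: T * T}| - #|E [set x in s]|) * 2 ^ (a * t.+1) <= _).
      by rewrite leq_mul2r card_setI_fiber orbT.
    rewrite -expnD leq_pexp2l// (leq_trans (leq_add (leqnn _) cE))//.
    by rewrite subnK// max_card.
  have : B a * 2 ^ (a * t.+1) <= 2 ^ (a * t) * 2 ^ #|{: T * T}|.
    apply: leq_trans (_ : #|T| ^ a * 2 ^ #|{: T * T}| <= _).
      by rewrite -card_tuple -sum_nat_const big_distrl leq_sum.
    by rewrite leq_mul2r mulnC expnM leq_exp2r// (ltnW nt) orbT.
  by rewrite mulnS addnC expnD mulnCA leq_pmul2l ?expn_gt0.
have := union_bound cov; rewrite leqNgt => /negP; apply.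
have -> : #|{: {set T * T}}| = 2 ^ #|{: T * T}|.
  by rewrite -!cardsT -card_powerset powersetT.
have := geometric_sum_lt #|T|.+1 (expn_gt0 2 _) Bgeo.
apply: leq_ltn_trans; rewrite big_add1/= big_mkord leq_sum// => a _.
rewrite /B; elim/big_rec2: _ => [|s m S _ h]; first by rewrite cards0.
by rewrite (leq_trans (leq_card_setU _ _))// leq_add2l.
Qed.

(** * Random assignment of colours to classes *)

(** The first three binomial terms of [(1 + 1/m)^j], cleared of denominators. At [j = m + 1] the
    bracket is [5m^2 + 3m], whence the ratio 2/5 in [exp_bound]. *)
Lemma bernoulli2 (m j : nat) :
  m ^ j * (2 * m ^ 2 + 2 * j * m + j * j.-1) <= 2 * m ^ 2 * m.+1 ^ j.
Proof.
elim: j => [|j IH]; first by rewrite !expn0; lia.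
have := leq_mul IH (leqnn m.+1); rewrite !expnS -!mulnA.
move: (m.+1 ^ j) (m ^ j) => x y; case: j {IH} => [|j] /=; nia.
Qed.

(* A quantitative form of (1 - 1/2k)^(2k) <= 2/5, the limit being 1/e. *)
Lemma exp_bound (k : nat) : 0 < k ->
  5 * (2 * k).-1 ^ (2 * k) <= 2 * (2 * k) ^ (2 * k).
Proof.
move=> k0; set m := (2 * k).-1; have m0 : 0 < m by lia.
have mk : 2 * k = m.+1 by lia.
rewrite mk; have := bernoulli2 m m.+1 => /=.
move: (m.+1 ^ _) (m ^ m.+1) => x y h.
have : m ^ 2 * (5 * y) <= m ^ 2 * (2 * x) by nia.
by rewrite leq_pmul2l// expn_gt0 m0.
Qed.

(* Double counting with weight [1] for a colour sent to [i] and [2] otherwise: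
   this is Markov's inequality for [2 ^ - X], [X] the number of colours sent to [i]. *)
Lemma few_colours_bound (U : finType) (k d : nat) (S : {set U}) (i : 'I_k) :
  #|[set f : {ffun U -> 'I_k} | #|[set c in S | f c == i]| <= d]|
    * (2 * k) ^ #|S| <= 2 ^ d * (2 * k).-1 ^ #|S| * k ^ #|U|.
Proof.
have k0 : 0 < k by case: i => i; case: (k).
set bad := [set f | _].
pose w c (j : 'I_k) := if c \in S then (if j == i then 1 else 2) else 1.
(* The sum factors over the colours: [1 + 2 (k - 1)] for each colour of [S], [k] for any other. *)
have wE : \sum_(f : {ffun U -> 'I_k}) \prod_c w c (f c) =
    (2 * k).-1 ^ #|S| * k ^ #|~: S|.
  rewrite -bigA_distr_bigA/= (bigID [in S])/=; congr (_ * _).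
    rewrite -prod_nat_const; apply: eq_bigr => c cS.
    rewrite (bigD1 i)//= /w cS eqxx (eq_bigr (fun=> 2)) => [|j /negPf->//].
    rewrite sum_nat_const; have := cardC1 i; rewrite card_ord.
    by rewrite /predC1 /= => ->; lia.
  rewrite -prod_nat_const; apply: eq_big => [c|c cS]; first by rewrite inE.
  by rewrite /w (negPf cS) sum_nat_const card_ord muln1.
(* A bad [f] sends at least [#|S| - d] colours of [S] away from [i], so its weight is at least
   [2 ^ (#|S| - d)]. *)
have : #|bad| * 2 ^ #|S| <= 2 ^ d * ((2 * k).-1 ^ #|S| * k ^ #|~: S|).
  rewrite -wE big_distrr/= -sum_nat_const big_mkcond leq_sum//= => f _.
  case: ifP => //; rewrite inE => fd.
  rewrite (bigID [in S])/= [X in _ * (_ * X)]big1 ?muln1; last first.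
    by move=> c /negPf cS; rewrite /w cS.
  rewrite (bigID (fun c => f c == i))/= big1 ?mul1n; last first.
    by move=> c /andP[cS fc]; rewrite /w cS fc.
  rewrite (eq_bigr (fun=> 2)) => [|c /andP[cS /negPf fc]]; last by rewrite /w cS fc.
  rewrite prod_nat_const -expnD leq_pexp2l//.
  rewrite -(cardsID [set c | f c == i] S) leq_add//.
    by apply: leq_trans fd; apply/subset_leq_card/subsetP => c; rewrite !inE.
  by apply/subset_leq_card/subsetP => c; rewrite !inE andbC.
move=> /(leq_mul (leqnn (k ^ #|S|))).
have -> : #|U| = #|S| + #|~: S| by rewrite cardsC.
by rewrite expnMn expnD; lia.
Qed.

(** For [t >= 2] it suffices that [2 * 64 ^ t <= 125 ^ t]. This fails at [t = 1], where [n <= 1] is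
    used instead. *)
Lemma log_power_bound (n t : nat) :
  0 < t -> n < 2 ^ t -> n * (2 * 32 ^ t) < 125 ^ t.
Proof.
case: t => [|[|t]]// _ nt; first by rewrite !expn1; lia.
apply: leq_trans (_ : 2 ^ t.+2 * (2 * 32 ^ t.+2) <= _).
  by rewrite ltn_pmul2r// muln_gt0 expn_gt0.
rewrite mulnCA -expnMn -[2 * 32]/64.
elim: t {nt} => // t IH; rewrite (expnS 64) (expnS 125); lia.
Qed.

Lemma colour_split (T U : finType) (k t : nat) (phi : T -> 'I_k)
    (L : T -> {set U}) :
  0 < k -> 0 < t -> #|T| < 2 ^ t -> (forall v, #|L v| = 6 * k * t) ->
  exists f : U -> 'I_k,
    forall v, (2 * t).+1 < #|[set c in L v | f c == phi v]|.
Proof.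
move=> k0 t0 nt sL; apply: contrapT => nof.
pose bad v := [set f : {ffun U -> 'I_k} | #|[set c in L v | f c == phi v]| <= (2 * t).+1].
have cov f : exists v, f \in bad v.
  apply: contrapT => nv; apply: nof; exists f => v; rewrite ltnNge.
  by apply/negP => h; apply: nv; exists v; rewrite inE.
(* The probability is at most [2 ^ (2t + 1) (1 - 1/2k) ^ (6kt)], hence at most [2 * 4 ^ t * (2/5) ^
   (3t) = 2 (32/125) ^ t]. *)
have badP v : #|bad v| * 125 ^ t <= 2 * 32 ^ t * k ^ #|U|.
  have := few_colours_bound (2 * t).+1 (L v) (phi v); rewrite sL -/(bad v).
  have : 125 ^ t * (2 * k).-1 ^ (6 * k * t) <= 8 ^ t * (2 * k) ^ (6 * k * t).
    have -> : 6 * k * t = (2 * k) * (3 * t) by lia.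
    rewrite -[125]/(5 ^ 3) -[8]/(2 ^ 3) -!expnM !(expnM _ (2 * k)) -!expnMn.
    by rewrite leq_exp2r ?exp_bound// muln_gt0.
  have : 0 < (2 * k) ^ (6 * k * t) by rewrite expn_gt0; apply/orP; left; lia.
  rewrite [2 ^ _.+1]expnS [2 ^ (2 * t)]expnM -[2 ^ 2]/4 -[32]/(4 * 8) [(4 * 8) ^ t]expnMn.
  move: (_ ^ (6 * k * t)) (_ ^ (6 * k * t)) (125 ^ t) (8 ^ t) (4 ^ t)
    (k ^ #|U|) #|bad v| => N M P e q K b N0 le1 le2.
  rewrite -(leq_pmul2l N0).
  have := leq_mul (leqnn P) le2.
  have := leq_mul (leqnn (2 * q * K)) le1.
  lia.
have := union_bound cov; rewrite card_ffun card_ord => le1.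
have : k ^ #|U| * 125 ^ t <= #|T| * (2 * 32 ^ t * k ^ #|U|).
  apply: leq_trans (leq_mul le1 (leqnn _)) _.
  by rewrite -sum_nat_const big_distrl leq_sum.
have -> : #|T| * (2 * 32 ^ t * k ^ #|U|) = k ^ #|U| * (#|T| * (2 * 32 ^ t)) by lia.
rewrite leq_pmul2l ?expn_gt0 ?k0// leqNgt => /negP; apply.
exact: log_power_bound.
Qed.

(** * Greedy list colouring and the main bound *)

(** A vertex with at most [d] neighbours in [A] is coloured after the rest of [A]: its neighbours
    there block at most [d] colours of its list. *)
Lemma greedy_list_colouring (T U : finType) (e : rel T) (d : nat)
    (L : T -> {set U}) :
  symmetric e -> irreflexive e ->
  (forall A : {set T}, A != set0 ->
    exists2 v, v \in A & #|[set y in A | e v y]| <= d) ->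
  (forall v, d < #|L v|) ->
  exists c : T -> U, (forall v, c v \in L v) /\
    forall x y, e x y -> c x != c y.
Proof.
move=> esym eirr deg sL.
suff greedy (A : {set T}) : exists c : T -> U, (forall v, c v \in L v) /\
    {in A &, forall x y, e x y -> c x != c y}.
  by have [c [cL cP]] := greedy setT; exists c; split=> // x y; apply: cP.
elim: {A}#|A| {-2}A (leqnn #|A|) => [|n IH] A cA.
  have ex v : exists a, a \in L v by apply/card_gt0P; have := sL v; lia.
  exists (fun v => xchoose (ex v)); split=> [v|x y]; first exact: xchooseP.
  by move: cA; rewrite leqn0 cards_eq0 => /eqP->; rewrite inE.
have [->|A0] := eqVneq A set0; first by apply: IH; rewrite cards0.
have [v vA dv] := deg A A0.
have [|c [cL cP]] := IH (A :\ v).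
  by move: cA; rewrite (cardsD1 v) vA add1n.
have /card_gt0P[a] : 0 < #|L v :\: c @: [set y in A | e v y]|.
  rewrite cardsD subn_gt0 (leq_ltn_trans _ (sL v))//.
  by rewrite (leq_trans _ dv)// (leq_trans _ (leq_imset_card c _))// subset_leq_card ?subsetIr.
rewrite !inE => /andP[aN aL].
exists (fun x => if x == v then a else c x); split=> [x|].
  by case: eqP => [->|].
have aP y : y \in A -> e v y -> a != c y.
  by move=> yA vy; apply: contra aN => /eqP->; apply: imset_f; rewrite inE yA.
move=> x y xA yA /=; case: (eqVneq x v) => [->|xv];
  case: (eqVneq y v) => [->|yv] exy.
- by rewrite eirr in exy.
- exact: aP.
- by rewrite eq_sym aP// esym.
- by apply: cP; rewrite ?inE ?xv ?yv.
Qed.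

(** Only finitely many colours occur in the lists. With a finite type of colours, the maps from
    colours to classes can be counted. *)
Lemma choosable_finite (T : finType) (G : sgraph T) (k : nat) :
  (forall (U : finType) (L : T -> {set U}), (forall v, #|L v| = k) ->
     exists c : T -> U, proper_colouring G c /\ forall v, c v \in L v) ->
  choosable G k.
Proof.
move=> fin C L sL.
pose U : {fset C} := (\bigcup_(v <- enum T) L v)%fset.
have LU v a : a \in L v -> a \in U.
  by move=> aL; apply/bigfcupP; exists v; rewrite ?mem_enum.
case: (fin U (fun v => [set x : U | val x \in L v])) => [v|c [pc cL]].
  rewrite -(sL v) cardE -(size_map val); apply/perm_size/uniq_perm.
  - by rewrite (map_inj_uniq val_inj) enum_uniq.
  - exact: fset_uniq.
  move=> a; apply/mapP/idP => [[x]|aL]; first by rewrite mem_enum inE => xL ->.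
  by exists [` LU _ _ aL]%fset; rewrite ?mem_enum ?inE.
exists (fun v => val (c v)); split=> [x y Gxy /val_inj|v]; first exact: pc.
by have := cL v; rewrite inE.
Qed.

(* [trunc_log 2 n] is the floor of the binary logarithm of [n]. *)
Theorem mainTheorem3 (T : finType) (G : sgraph T) (n : nat) (hn : #|T| = n) :
  list_chromatic G <= 6 * graph_dichromatic G * (1 + trunc_log 2 n).
Proof.
set k := graph_dichromatic G; set t := 1 + _.
have nt : #|T| < 2 ^ t by rewrite hn trunc_log_ltn.
rewrite /list_chromatic; case: ex_minnP => m _; apply; apply/asboolP.
apply: choosable_finite => U L sL.
(* Without vertices [k] is [0], and colours cannot be sent to classes. *)
have [T0|[z _]] : (forall v : T, False) \/ exists v : T, True.
  by case: (pickP T) => [v _|h]; [right; exists v|left=> v; have := h v].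
  by exists (fun v => False_rect _ (T0 v)); split=> v; case: (T0 v).
have [D oD degD] := sparse_acyclic_orientation G nt.
have Dk : dichromatic D <= k by apply: leq_bigmax_cond.
(* Any set inside one class of a dicolouring of [D] is acyclic in [D], so the degree bound applies
   to it. *)
have [phi degphi] : exists phi : T -> 'I_k, forall A : {set T}, A != set0 ->
    {in A &, forall x y, phi x = phi y} ->
    exists2 v, v \in A & #|[set y in A | G v y]| <= (2 * t).+1.
  move: Dk; rewrite /dichromatic; case: ex_minnP => j /asboolP[phi dphi] _ jk.
  exists (fun x => widen_ord jk (phi x)) => A A0 cA; apply: degD => //.
  have /set0Pn[u uA] := A0; move=> c /andP[cyc uc]; apply: (dphi (phi u)).
  apply/andP; split=> //; apply: sub_cycle cyc => x y /and3P[xA yA xy].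
  have equ w : w \in A -> phi w == phi u.
    by move=> wA; apply/eqP/val_inj; have := congr1 val (cA _ _ wA uA).
  by rewrite /induced/= !inE !equ.
have k0 : 0 < k by apply: leq_trans (ltn_ord (phi z)).
have [f fL] := colour_split phi k0 (isT : 0 < t) nt sL.
case: (@greedy_list_colouring T U [rel x y | G x y && (phi x == phi y)]
         (2 * t).+1 (fun v => [set c in L v | f c == phi v])) => //.
- by move=> x y; rewrite /= edge_sym eq_sym.
- by move=> x; rewrite /= edge_irr.
- move=> A /set0Pn[u uA].
  case: (degphi [set x in A | phi x == phi u]) => [||v].
  + by apply/set0Pn; exists u; rewrite inE uA eqxx.
  + by move=> x y; rewrite !inE => /andP[_ /eqP->] /andP[_ /eqP->].
  rewrite inE => /andP[vA /eqP vu] dv; exists v => //; apply: leq_trans dv.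
  apply/subset_leq_card/subsetP => y; rewrite !inE /= vu.
  by rewrite [phi u == _]eq_sym -!andbA [G v y && _]andbC.
move=> c [cL cP]; exists c; split=> [x y Gxy cxy|v]; last first.
  by have := cL v; rewrite inE => /andP[].
have := cP x y; rewrite /= Gxy cxy eqxx => /implyP.
have := cL x; have := cL y; rewrite !inE cxy => /andP[_ /eqP<-] /andP[_ /eqP->].
by rewrite eqxx.
Qed.
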